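(* Let $n\ge 1$ and $\pi\in S_n$. For $i\ge 1$ let $\alpha_i(\pi)$ be the minimal number of elements that one can remove from $\pi$ so that what remains is a disjoint union of $i$ increasing subsequences. Then $$\mathrm{bump}(\pi)=\sum_{i\ge 1}\alpha_i(\pi).$$
   Context: $S_n$ is the set of permutations $\pi=\pi_1\cdots\pi_n$ (one-line notation) of $\{1,\ldots,n\}$. In the definition of $\alpha_i(\pi)$, the increasing subsequences are allowed to be empty, so $\alpha_i(\pi)=0$ for all sufficiently large $i$. Robinson–Schensted (RS) correspondence: tableaux are fillings of Young diagrams with distinct positive integers increasing along rows and down columns. To insert $k$ into a tableau $P$ (written $P\leftarrow k$), start with the top row: (I1) if $k$ is greater than or equal to the rightmost entry of the current row, or the current row is empty, append $k$ at the end of that row and stop; (I2) otherwise let $y$ be the leftmost entry of the current row with $k<y$, replace $y$ by $k$ (this is one bump), set $k:=y$, move down one row and go to (I1). For $\pi\in S_n$, start with the empty tableau $P_0$ and for $i=0,\ldots,n-1$ let $P_{i+1}=P_i\leftarrow\pi_{i+1}$. The statistic $\mathrm{bump}(\pi)$ is the total number of bumps that occur over all these insertions. *)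

(* Defs.v *)
From mathcomp Require Import all_boot all_fingroup.

Set Implicit Arguments.
Unset Strict Implicit.
Unset Printing Implicit Defensive.

(* Permutations act on 'I_n = {0, ..., n-1}; the successor shifts the one-line
   notation back to the letters 1, ..., n. *)
Definition one_line (n : nat) (pi : 'S_n) : seq nat :=
  [seq (val (pi i)).+1 | i <- enum 'I_n].

(* A tableau is the sequence of its rows, top row first. [rs_insert P k] is the
   tableau P <- k together with the number of bumps made by this insertion; the
   case [P = [::]] is an insertion into an empty row. The index j is that of
   the leftmost entry greater than k, which exists when the last entry is. *)
Fixpoint rs_insert (P : seq (seq nat)) (k : nat) : seq (seq nat) * nat :=
  match P with
  | [::] => ([:: [:: k]], 0)
  | r :: P' =>
      if (r == [::]) || (last 0 r <= k) then (rcons r k :: P', 0)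
      else
        let j := find (fun y => k < y) r in
        let: (Q, b) := rs_insert P' (nth 0 r j) in
        (set_nth 0 r j k :: Q, b.+1)
  end.

Fixpoint bump_from (P : seq (seq nat)) (w : seq nat) : nat :=
  match w with
  | [::] => 0
  | k :: w' => let: (Q, b) := rs_insert P k in b + bump_from Q w'
  end.

Definition rs_bump (n : nat) (pi : 'S_n) : nat := bump_from [::] (one_line pi).

(* Subsequences of pi are represented by their sets of positions. *)
Definition increasing_on (n : nat) (pi : 'S_n) (A : {set 'I_n}) : bool :=
  [forall x in A, forall y in A, (x < y) ==> (pi x < pi y)].

(* The members F a of the family may be empty. *)
Definition union_of_increasing (n : nat) (pi : 'S_n) (i : nat)
    (S : {set 'I_n}) : bool :=
  [exists F : {ffun 'I_i -> {set 'I_n}},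
    [&& [forall a, increasing_on pi (F a)],
        [forall a, forall b, (a != b) ==> [disjoint F a & F b]]
      & S == \bigcup_a F a]].

(* R is the set of positions of the removed elements; [setT] is only the
   default candidate needed by [arg min], and it is admissible (all F a empty). *)
Definition alpha (n : nat) (i : nat) (pi : 'S_n) : nat :=
  #|[arg min_(R < [set: 'I_n] | union_of_increasing pi i (~: R)) #|R|]|.

Lemma union_of_increasing_setT (n : nat) (pi : 'S_n) (i : nat) :
  union_of_increasing pi i (~: [set: 'I_n]).
Proof.
apply/existsP; exists [ffun=> set0]; apply/and3P; split.
- by apply/forallP => a; apply/forall_inP => x; rewrite ffunE inE.
- by apply/forallP => a; apply/forallP => b; rewrite !ffunE disjoints_subset sub0set implybT.
- by rewrite setCT eq_sym; apply/eqP/big1 => a _; rewrite ffunE.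
Qed.

(* A series of natural numbers converges exactly when its partial sums are
   eventually constant. *)
Definition series_from1 (a : nat -> nat) (s : nat) : Prop :=
  exists N, forall M, N <= M -> \sum_(1 <= i < M) a i = s.

(* Main.v *)
Require Import Defs.
From mathcomp Require Import all_boot all_fingroup.
From mathcomp Require Import zify.

Set Implicit Arguments.
Unset Strict Implicit.
Unset Printing Implicit Defensive.

(** Both sides of the identity are read off the shape lambda of the insertion
    tableau P(pi).

    An insertion that makes b bumps enlarges row b of the tableau (rows counted
    from 0) by one cell, so the total number of bumps is the sum of
    b * lambda_b ([bump_from_weight]).  On the other side, Greene's theorem says
    that k disjoint increasing subsequences cover at most
    lambda_0 + ... + lambda_(k-1) elements, with equality for a suitable choice,
    so that alpha_k is the number of cells below the first k rows
    ([alpha_drop_shape]).  The row of index b lies below the first k rows for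
    exactly b values of k >= 1, hence the sum of the alpha_k is again the sum
    of b * lambda_b ([sum_drops_row_weight]).

    Greene's theorem is proved through Knuth relations.  A family of k disjoint
    increasing subsequences is a colouring of the letters of a word: colour
    c < k means membership in subsequence c, any colour c >= k means removal.
    Words are allowed to have repeated letters, and increasing is taken weakly,
    since row insertion puts equal letters to the right; no distinctness has to
    be carried through the proof.  The two Knuth relations preserve the numbers
    of letters that can be kept, in every context: if an exchange of adjacent
    letters breaks a subsequence, exchanging the tails of two subsequences
    repairs the colouring ([knuth_yxz], [knuth_xzy]).  Inserting a letter into a
    row is a chain of such exchanges ([row_insert_equiv]), so a word is
    equivalent to the word that reads its tableau row by row from the bottom
    ([reading_rs_tableau]).  For that reading word the claim is visible: the
    first k rows are k increasing subsequences ([colorable_rows]), while a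
    column is strictly decreasing in the reading word and so meets each
    subsequence at most once, which bounds the kept letters of every column by
    k ([tableau_kept_bound]). *)

(** * Coloured words and Knuth relations *)

(** A coloured word is a sequence of pairs (letter, colour); the relation is the
    condition on a letter [p] placed to the left of a letter [q]. *)
Definition compatible (k : nat) (p q : nat * nat) : bool :=
  (p.2 == q.2) && (p.2 < k) ==> (p.1 <= q.1).

Definition kept (k : nat) (W : seq (nat * nat)) : nat :=
  count (fun p => p.2 < k) W.

Definition colorable (k : nat) (w : seq nat) (m : nat) : Prop :=
  exists W, [/\ unzip1 W = w, pairwise (compatible k) W & kept k W = m].

(** Quantifying over the contexts [u] and [v] makes this a congruence for
    concatenation, as the plactic congruence is, without generating it from the
    Knuth relations. *)
Definition greene_equiv (w w' : seq nat) : Prop :=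
  forall u v k m, colorable k (u ++ w ++ v) m <-> colorable k (u ++ w' ++ v) m.

Lemma greene_equiv_sym w w' : greene_equiv w w' -> greene_equiv w' w.
Proof. by move=> H u v k m; split=> /H. Qed.

Lemma greene_equiv_trans w1 w2 w3 :
  greene_equiv w1 w2 -> greene_equiv w2 w3 -> greene_equiv w1 w3.
Proof. by move=> H K u v k m; split=> [/H/K|/K/H]. Qed.

Lemma greene_equiv_cat u v w w' :
  greene_equiv w w' -> greene_equiv (u ++ w ++ v) (u ++ w' ++ v).
Proof. by move=> H u' v' k m; have := H (u' ++ u) (v ++ v') k m; rewrite -!catA. Qed.

Lemma greene_equiv_catl u w w' :
  greene_equiv w w' -> greene_equiv (u ++ w) (u ++ w').
Proof. by move=> /(greene_equiv_cat u [::]); rewrite !cats0. Qed.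

Lemma greene_equiv_catr v w w' :
  greene_equiv w w' -> greene_equiv (w ++ v) (w' ++ v).
Proof. exact: (@greene_equiv_cat [::]). Qed.

Definition recolor (f : nat -> nat) (p : nat * nat) := (p.1, f p.2).

Definition swap_color (i j c : nat) : nat :=
  if c == i then j else if c == j then i else c.

Lemma split_coloring (W : seq (nat * nat)) u x y z v :
  unzip1 W = u ++ [:: x; y; z] ++ v ->
  exists U V i j l, [/\ unzip1 U = u, unzip1 V = v &
    W = U ++ [:: (x, i); (y, j); (z, l)] ++ V].
Proof.
elim: u W => [|a u IH] [|[b c] W] //=.
  case: W => [|[b1 c1] [|[b2 c2] V]] //= [-> -> -> <-].
  by exists [::], V, c, c1, c2.
case=> -> /IH [U [V [i [j [l [<- <- ->]]]]]].
by exists ((a, c) :: U), V, i, j, l.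
Qed.

(** Only the comparisons that involve the replaced factor [L] have to be checked
    again.  The recolouring [f] of the suffix is the identity or the exchange of
    the tails of two subsequences; an injective map that respects the distinction
    between kept and removed letters changes no comparison inside the suffix.
    In the last hypothesis [a] lies before [L] and keeps its colour while [b]
    lies after [L] and is recoloured: they are compared through the letters of
    [L]. *)
Lemma colorable_replace k (U L V L' : seq (nat * nat)) f :
  injective f -> (forall c, (f c < k) = (c < k)) ->
  pairwise (compatible k) (U ++ L ++ V) ->
  pairwise (compatible k) L' -> kept k L' = kept k L ->
  (forall a, all (compatible k a) L -> all (compatible k a) L') ->
  (forall b, all (compatible k ^~ b) L -> all (compatible k ^~ (recolor f b)) L') ->
  (forall a b, all (compatible k a) L -> all (compatible k ^~ b) L ->
     compatible k a b -> compatible k a (recolor f b)) ->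
  colorable k (unzip1 U ++ unzip1 L' ++ unzip1 V) (kept k (U ++ L ++ V)).
Proof.
move=> injf fk; rewrite !pairwise_cat !allrel_catr.
case/and3P=> /andP[UL UV] pU /and3P[LV _ pV] pL' keptL' aL' bL' ab.
exists (U ++ L' ++ map (recolor f) V); split.
- by rewrite /unzip1 !map_cat -map_comp.
- rewrite !pairwise_cat !allrel_catr pU pL' pairwise_map /=.
  apply/and3P; split.
  + apply/andP; split.
      by apply/allrelP=> a b aU; apply/allP: b; apply/aL'/allP=> b; apply: (allrelP UL).
    apply/allrelP=> a _ aU /mapP[b bV ->]; apply: ab.
    * by apply/allP=> c; apply: (allrelP UL).
    * by apply/allP=> c cL; apply: (allrelP LV).
    * exact: (allrelP UV).
  + apply/allrelP=> a _ + /mapP[b bV ->]; move: a; apply/allP/bL'/allP=> c cL.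
    exact: (allrelP LV).
  + apply: sub_pairwise pV => p q.
    by rewrite /compatible /= (inj_eq injf) fk.
rewrite /kept !count_cat -!/(kept k _) keptL' /kept count_map; congr (_ + (_ + _)).
by apply: eq_count => p /=; rewrite fk.
Qed.

Lemma swap_color_inj i j : injective (swap_color i j).
Proof.
move=> c d; rewrite /swap_color.
by case: (c =P i); case: (c =P j); case: (d =P i); case: (d =P j); lia.
Qed.

Lemma swap_color_lt k i j c : i < k -> j < k -> (swap_color i j c < k) = (c < k).
Proof. by rewrite /swap_color; case: (c =P i); case: (c =P j); lia. Qed.

(** Each condition of [colorable_replace], for explicit triples, is linear
    arithmetic once every colour has been compared with the two colours that are
    exchanged. *)
Ltac color_cases pL :=
  try move=> [a ca]; try move=> [b cb]; move: pL;
  rewrite /kept /compatible /recolor /swap_color /=;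
  repeat (match goal with |- context [if ?c == ?i then _ else _] => case: (c =P i) end);
  lia.

(** Only a subsequence i that contains both x and z is broken when z moves before
    x; the letter y, being greater than x and to its left, has another colour j.
    If y is kept, the tails are exchanged: the subsequence of y goes on with z and
    the former end of i, whereas i goes on from x with the former end of j.  If y
    is removed, it takes the place of x. *)
Lemma knuth_yxz x y z : x < y -> y <= z ->
  greene_equiv [:: y; x; z] [:: y; z; x].
Proof.
move=> xy yz u v k m; split=> -[W [/split_coloring[U [V [j [i [l [<- <- ->]]]]]] pW <-]];
  have := pW; rewrite !pairwise_cat => /and3P[_ _ /and3P[_ pL _]].
  (* If x and z are not in one subsequence, every colour can stay. *)
  have [/andP[/eqP eil ik]|nil] := boolP ((i == l) && (i < k)); last first.
    apply: (@colorable_replace k U _ V [:: (y, j); (z, l); (x, i)] id) => //; color_cases pL.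
  (* The colour j of y decides: kept when j < k, removed otherwise. *)
  subst l; have [jk|kj] := ltnP j k.
    apply: (@colorable_replace k U _ V [:: (y, j); (z, j); (x, i)] (swap_color i j)) => //;
      [exact: swap_color_inj | by move=> c; rewrite swap_color_lt | ..]; color_cases pL.
  apply: (@colorable_replace k U _ V [:: (y, i); (z, i); (x, j)] id) => //; color_cases pL.
apply: (@colorable_replace k U _ V [:: (y, j); (x, l); (z, i)] id) => //; color_cases pL.
Qed.

(** The same repair as in [knuth_yxz], mirrored: the subsequence i of x and z goes
    on from x with y and the former end of the subsequence of y, which now goes on
    with z and the former end of i; a removed y takes the place of z. *)
Lemma knuth_xzy x y z : x <= y -> y < z ->
  greene_equiv [:: x; z; y] [:: z; x; y].
Proof.
move=> xy yz u v k m; split=> -[W [/split_coloring[U [V [i [l [j [<- <- ->]]]]]] pW <-]];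
  have := pW; rewrite !pairwise_cat => /and3P[_ _ /and3P[_ pL _]].
  (* If x and z are not in one subsequence, every colour can stay. *)
  have [/andP[/eqP eil ik]|nil] := boolP ((i == l) && (i < k)); last first.
    apply: (@colorable_replace k U _ V [:: (z, l); (x, i); (y, j)] id) => //; color_cases pL.
  (* The colour j of y decides: kept when j < k, removed otherwise. *)
  subst l; have [jk|kj] := ltnP j k.
    apply: (@colorable_replace k U _ V [:: (z, j); (x, i); (y, i)] (swap_color i j)) => //;
      [exact: swap_color_inj | by move=> c; rewrite swap_color_lt | ..]; color_cases pL.
  apply: (@colorable_replace k U _ V [:: (z, j); (x, i); (y, i)] id) => //; color_cases pL.
apply: (@colorable_replace k U _ V [:: (x, l); (z, i); (y, j)] id) => //; color_cases pL.
Qed.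

(** * Row insertion *)

(** The first half of a row insertion: the inserted letter [k] travels left over
    the entries to the right of the bumped entry [y], by moves c z k to c k z. *)
Lemma bump_through_suffix y b k : path leq y b -> k < y ->
  greene_equiv (y :: b ++ [:: k]) (y :: k :: b).
Proof.
elim: b y => [|c b IH] y //= /andP[yc cb] ky.
apply: (@greene_equiv_trans _ (y :: c :: k :: b)).
  by apply: (@greene_equiv_catl [:: y]); apply: IH => //; apply: leq_trans yc.
exact/(@greene_equiv_catr b [:: y; c; k] [:: y; k; c])/greene_equiv_sym/knuth_yxz.
Qed.

(** The second half: the bumped entry [y] travels left over the entries that
    precede it, by moves c y d to y c d, in which d <= k < y. *)
Lemma bump_through_prefix y a k b : sorted leq (rcons a k) -> k < y ->
  greene_equiv (a ++ y :: k :: b) (y :: a ++ k :: b).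
Proof.
elim: a => [|c a IH] //= ck ky.
apply: (@greene_equiv_trans _ (c :: y :: a ++ k :: b)).
  apply: (@greene_equiv_catl [:: c]); apply: IH => //.
  exact: path_sorted ck.
case: a ck {IH} => [|d a] /= /andP[cd].
  by move=> _; apply/(@greene_equiv_catr b [:: c; y; k] [:: y; c; k])/knuth_xzy.
rewrite (path_sortedE leq_trans) all_rcons => /andP[/andP[dk _] _].
apply/(@greene_equiv_catr (a ++ k :: b) [:: c; y; d] [:: y; c; d])/knuth_xzy => //.
exact: leq_ltn_trans ky.
Qed.

Definition reading (P : seq (seq nat)) : seq nat := flatten (rev P).

Lemma reading_cons r P : reading (r :: P) = reading P ++ r.
Proof. by rewrite /reading rev_cons flatten_rcons. Qed.

Definition bump_position (r : seq nat) (k : nat) : nat := find (fun y => k < y) r.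

Definition bumped (r : seq nat) (k : nat) : nat := nth 0 r (bump_position r k).

Definition appends (r : seq nat) (k : nat) : bool := (r == [::]) || (last 0 r <= k).

Definition row_insert (r : seq nat) (k : nat) : seq nat :=
  if appends r k then rcons r k else set_nth 0 r (bump_position r k) k.

(** The insertion function with its row operation isolated, so that statements
    about one row can be proved apart from the recursion over rows. *)
Lemma rs_insert_cons r P k : rs_insert (r :: P) k =
  if appends r k then (row_insert r k :: P, 0)
  else (row_insert r k :: (rs_insert P (bumped r k)).1,
        (rs_insert P (bumped r k)).2.+1).
Proof.
rewrite /row_insert /= -/(appends r k) -/(bump_position r k) -/(bumped r k).
by case: (appends r k) => //; case: (rs_insert P _).
Qed.

Lemma head_rs_insert P k : head [::] (rs_insert P k).1 = row_insert (head [::] P) k.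
Proof. by case: P => // r P; rewrite rs_insert_cons; case: (appends r k). Qed.

Lemma bump_spec r k : sorted leq r -> ~~ appends r k ->
  exists a b, [/\ r = a ++ bumped r k :: b, row_insert r k = a ++ k :: b,
    size a = bump_position r k, k < bumped r k & all (fun x => x <= k) a].
Proof.
move=> r_sorted napp; set j := bump_position r k.
have hasr : has (fun y => k < y) r.
  case/norP: napp; case: r r_sorted @j => // x s _ _ _; rewrite -ltnNge => ltk.
  by apply/hasP; exists (last x s); rewrite ?mem_last.
have jr : j < size r by rewrite -has_find.
exists (take j r), (drop j.+1 r); split.
- by rewrite /bumped -drop_nth // cat_take_drop.
- by rewrite /row_insert (negbTE napp) set_nthE jr.
- by rewrite size_take jr.
- exact: nth_find hasr.
apply/(all_nthP 0) => i; rewrite size_take jr => ij.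
by rewrite nth_take // leqNgt (before_find 0 ij).
Qed.

Lemma row_insert_sorted r k : sorted leq r -> sorted leq (row_insert r k).
Proof.
move=> r_sorted; have [app|napp] := boolP (appends r k).
  rewrite /row_insert app; case: r app r_sorted => //= x s.
  by rewrite /appends /= rcons_path => -> ->.
have [a [b [er -> _ ky ak]]] := bump_spec r_sorted napp.
move: r_sorted; rewrite er !(sorted_pairwise leq_trans) !pairwise_cat !allrel_consr /=.
case/and3P=> /andP[_ ->] -> /andP[yb ->]; rewrite ak !andbT.
by apply: sub_all yb => x; apply: leq_trans; apply: ltnW.
Qed.

Lemma size_row_insert r k :
  sorted leq r -> size (row_insert r k) = size r + appends r k.
Proof.
move=> r_sorted; have [app|napp] := boolP (appends r k).
  by rewrite /row_insert app size_rcons addn1.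
have [a [b [er -> _ _ _]]] := bump_spec r_sorted napp.
by rewrite er !size_cat addn0.
Qed.

Lemma row_insert_equiv r k : sorted leq r -> ~~ appends r k ->
  greene_equiv (r ++ [:: k]) (bumped r k :: row_insert r k).
Proof.
move=> r_sorted napp.
have [a [b [er -> _ ky ak]]] := bump_spec r_sorted napp.
move: r_sorted; rewrite {1 2}er; move: (bumped r k) ky => y ky.
rewrite (sorted_pairwise leq_trans) pairwise_cat.
case/and3P=> _ pa; rewrite -(sorted_pairwise leq_trans) => yb.
apply: (@greene_equiv_trans _ (a ++ y :: k :: b)).
  by rewrite -catA; apply/greene_equiv_catl/bump_through_suffix.
apply: bump_through_prefix => //.
by rewrite (sorted_pairwise leq_trans) pairwise_rcons ak.
Qed.

(** [r] can lie directly above [s] in a tableau. *)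
Definition dominates (r s : seq nat) : bool :=
  (size s <= size r) && all (fun j => nth 0 r j < nth 0 s j) (iota 0 (size s)).

Lemma dominatesP r s :
  reflect (size s <= size r /\ forall j, j < size s -> nth 0 r j < nth 0 s j)
          (dominates r s).
Proof.
apply: (iffP andP) => -[H K]; split=> //.
  by move=> j js; apply: (allP K); rewrite mem_iota.
by apply/allP=> j; rewrite mem_iota => /K.
Qed.

Lemma dominates_trans : transitive dominates.
Proof.
move=> s r t /dominatesP[rs crs] /dominatesP[st cst].
apply/dominatesP; split=> [|j jt]; first exact: leq_trans rs.
by apply: ltn_trans (cst j jt); apply/crs/(leq_trans jt).
Qed.

(** The letter bumped from column j of [r] lands in [s] at a column at most j:
    either [s] ends before column j, or its entry in column j exceeds the bumped
    letter.  Up to column j the entries of the new row [r] are smaller than the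
    bumped letter, so the letter may stand below them; elsewhere the upper row
    has not increased and the lower row has not changed. *)
Lemma dominates_row_insert r s k : sorted leq r -> sorted leq s ->
  dominates r s -> ~~ appends r k ->
  dominates (row_insert r k) (row_insert s (bumped r k)).
Proof.
move=> r_sorted s_sorted /dominatesP[sz lt_rs] napp.
have [a [b [er _ sa ky ak]]] := bump_spec r_sorted napp.
set y := bumped r k in er ky *; set j := bump_position r k in sa.
have eI' i : nth 0 (row_insert r k) i = if i == j then k else nth 0 r i.
  by rewrite /row_insert (negbTE napp) nth_set_nth.
have jr : j < size r by rewrite er size_cat sa /= -addSnnS leq_addr.
have rj : nth 0 r j = y by [].
have szI : size (row_insert r k) = size r.
  by rewrite size_row_insert // (negbTE napp) addn0.
have rI i : nth 0 (row_insert r k) i <= nth 0 r i.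
  by rewrite eI'; case: eqP => // ->; rewrite rj ltnW.
have lowI i : i <= j -> nth 0 (row_insert r k) i < y.
  rewrite leq_eqVlt eI' => /orP[/eqP->|ij]; first by rewrite eqxx.
  rewrite (ltn_eqF ij) er nth_cat sa ij; apply: leq_ltn_trans ky.
  by apply: (allP ak); rewrite mem_nth ?sa.
apply/dominatesP; rewrite szI; have [app|napp'] := boolP (appends s y).
  have sj : size s <= j.
    rewrite leqNgt; apply/negP=> js; move: app (lt_rs j js); rewrite rj /appends.
    case/orP=> [/eqP es|]; first by rewrite es in js.
    rewrite -nth_last leqNgt => /negP + yj; apply; apply: leq_trans yj _.
    by apply: (sorted_leq_nth leq_trans leqnn 0 s_sorted); rewrite ?inE; lia.
  rewrite /row_insert app size_rcons; split=> [|i]; first exact: leq_ltn_trans jr.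
  rewrite ltnS leq_eqVlt nth_rcons => /orP[/eqP->|si].
    by rewrite ltnn eqxx; apply: lowI.
  by rewrite si; apply: leq_ltn_trans (lt_rs _ si); apply: rI.
have [a' [b' [es _ sa' _ ay]]] := bump_spec s_sorted napp'.
set j' := bump_position s y in sa'.
have j's : j' < size s by rewrite es size_cat sa' /= -addSnnS leq_addr.
(* Every entry of s to the left of column j' is at most y, unlike entry j. *)
have jj' : j' <= j.
  rewrite leqNgt; apply/negP=> jj'; have := lt_rs j (ltn_trans jj' j's).
  rewrite rj ltnNge; apply/negP; rewrite negbK es nth_cat sa' jj'.
  by apply: (allP ay); rewrite mem_nth ?sa'.
rewrite size_row_insert // (negbTE napp') addn0; split=> // i si.
rewrite /row_insert (negbTE napp') nth_set_nth /= -/j'.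
case: eqP => [->|_]; first exact: lowI.
by apply: leq_ltn_trans (lt_rs _ si); apply: rI.
Qed.

Definition tableau (P : seq (seq nat)) : bool :=
  all (sorted leq) P && sorted dominates P.

Lemma tableau_cons r P : tableau (r :: P) =
  [&& sorted leq r, dominates r (head [::] P) & tableau P].
Proof.
rewrite /tableau /=; case: P => [|s P] /=; first by rewrite !andbT.
by rewrite -!andbA; do ?bool_congr; rewrite andbCA; do ?bool_congr.
Qed.

Lemma dominates_rcons r s k : dominates r s -> dominates (rcons r k) s.
Proof.
case/dominatesP=> sz lt; apply/dominatesP; rewrite size_rcons leqW //.
by split=> // j js; rewrite nth_rcons (leq_trans js sz) lt.
Qed.

Lemma tableau_head P : tableau P -> sorted leq (head [::] P).
Proof. by case: P => // r P; rewrite tableau_cons => /and3P[]. Qed.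

Lemma rs_insert_tableau P k : tableau P -> tableau (rs_insert P k).1.
Proof.
elim: P k => [|r P IH] k //; rewrite tableau_cons rs_insert_cons => /and3P[rs rP tP].
have [app|napp] := boolP (appends r k); rewrite tableau_cons row_insert_sorted //=.
  by rewrite tP /row_insert app dominates_rcons.
by rewrite IH // head_rs_insert dominates_row_insert // tableau_head.
Qed.

(** One row at a time: the inserted letter passes through the row [r] on the right
    of the reading word and leaves on its left as the bumped letter, where it is
    appended to the reading word of the remaining rows. *)
Lemma reading_rs_insert P k : tableau P ->
  greene_equiv (reading P ++ [:: k]) (reading (rs_insert P k).1).
Proof.
elim: P k => [|r P IH] k //; rewrite tableau_cons rs_insert_cons => /and3P[rs _ tP].
have [app|napp] := boolP (appends r k).
  by rewrite /row_insert app /= !reading_cons -catA cats1.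
rewrite /= !reading_cons -catA.
apply: (@greene_equiv_trans _ (reading P ++ bumped r k :: row_insert r k)).
  exact/greene_equiv_catl/row_insert_equiv.
by rewrite -cat_rcons -cats1; apply/greene_equiv_catr/IH.
Qed.

Definition rs_tableau (P : seq (seq nat)) (w : seq nat) : seq (seq nat) :=
  foldl (fun P k => (rs_insert P k).1) P w.

Lemma rs_tableau_tableau P w : tableau P -> tableau (rs_tableau P w).
Proof. by elim: w P => //= k w IH P tP; apply/IH/rs_insert_tableau. Qed.

Lemma reading_rs_tableau P w : tableau P ->
  greene_equiv (reading P ++ w) (reading (rs_tableau P w)).
Proof.
elim: w P => [|k w IH] P tP /=; first by rewrite cats0.
apply: greene_equiv_trans (IH _ (rs_insert_tableau k tP)).
by rewrite -cat1s catA; apply/greene_equiv_catr/reading_rs_insert.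
Qed.

(** The sum of b * (length of row b): every row counts once for each row above
    it. *)
Fixpoint row_weight (sh : seq nat) : nat :=
  if sh is _ :: sh' then row_weight sh' + sumn sh' else 0.

Lemma rs_insert_shape P k : tableau P ->
  sumn (shape (rs_insert P k).1) = (sumn (shape P)).+1 /\
  row_weight (shape (rs_insert P k).1) = row_weight (shape P) + (rs_insert P k).2.
Proof.
elim: P k => [|r P IH] k //; rewrite tableau_cons rs_insert_cons => /and3P[rs _ tP].
have := size_row_insert k rs; case: (appends r k) => /= ->; first by split; lia.
by have [-> ->] := IH (bumped r k) tP; split; lia.
Qed.

Lemma bump_from_weight P w : tableau P ->
  sumn (shape (rs_tableau P w)) = sumn (shape P) + size w /\
  row_weight (shape (rs_tableau P w)) = row_weight (shape P) + bump_from P w.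
Proof.
elim: w P => [|k w IH] P tP /=; first by rewrite !addn0.
have [sQ wQ] := rs_insert_shape k tP; have tQ := rs_insert_tableau k tP.
case: (rs_insert P k) sQ wQ tQ => Q b /= sQ wQ /IH[-> ->].
by rewrite sQ wQ; split; lia.
Qed.

(** * Kept letters in the reading word of a tableau *)

(** Colour row b with b.  The induction over the rows starts the colours at an
    arbitrary [i]. *)
Lemma colorable_rows k P : all (sorted leq) P ->
  colorable k (reading P) (sumn (take k (shape P))).
Proof.
suff H i : all (sorted leq) P -> exists W,
    [/\ unzip1 W = reading P, pairwise (compatible k) W,
        kept k W = sumn (take (k - i) (shape P)) & all (fun p => i <= p.2) W].
  by move=> /(H 0)[W [? ? + _]]; rewrite subn0; exists W.
elim: P i => [|r P IH] i /=; first by exists [::].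
case/andP=> rs /(IH i.+1)[W [eW pW kW gW]].
exists (W ++ [seq (x, i) | x <- r]); split.
- by rewrite /unzip1 map_cat -map_comp map_id reading_cons -eW.
- rewrite pairwise_cat pW pairwise_map; apply/and3P; split=> //.
    apply/allrelP=> p _ /(allP gW) ip /mapP[x _ ->].
    by rewrite /compatible /= gtn_eqF.
  move: rs; rewrite (sorted_pairwise leq_trans); apply: sub_pairwise => x y /=.
  by rewrite /compatible /= => ->; rewrite implybT.
- rewrite /kept count_cat -/(kept k W) kW count_map /=.
  have [ik|ki] := ltnP i k.
    rewrite -(subnSK ik) /= addnC; congr (_ + _).
    by rewrite (eq_count (a2 := predT)) ?count_predT // => x /=; rewrite ik.
  have [-> ->] : k - i.+1 = 0 /\ k - i = 0 by lia.
  by rewrite !take0 (eq_count (a2 := pred0)) ?count_pred0 // => x /=; rewrite ltnNge ki.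
rewrite all_cat; apply/andP; split; last by apply/allP=> _ /mapP[x _ ->] /=.
by apply: sub_all gW => p /ltnW.
Qed.

Lemma unzip1_flatten (P : seq (seq nat)) (W : seq (nat * nat)) :
  unzip1 W = flatten P -> exists C, W = flatten C /\ map unzip1 C = P.
Proof.
elim: P W => [|r P IH] W /=; first by case: W => // _; exists [::].
move=> eW; have /IH[C [eC <-]] : unzip1 (drop (size r) W) = flatten P.
  by rewrite /unzip1 map_drop -/(unzip1 W) eW drop_size_cat.
exists (take (size r) W :: C); split; first by rewrite /= -eC cat_take_drop.
by rewrite /= {1}/unzip1 map_take -/(unzip1 W) eW take_size_cat.
Qed.

Definition column (C : seq (seq (nat * nat))) (j : nat) : seq (nat * nat) :=
  [seq nth (0, 0) r j | r <- C & j < size r].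

(** Extending the range to a common bound [N] lets the rows be summed column by
    column. *)
Lemma count_row (T : Type) (x0 : T) (a : pred T) (r : seq T) N : size r <= N ->
  count a r = \sum_(0 <= j < N) ((j < size r) && a (nth x0 r j)).
Proof.
move=> rN; rewrite -sum1_count (big_nth x0) big_mkcond (big_nat_widen _ _ N) //=.
rewrite big_mkcond; apply: eq_bigr => j _ /=.
by case: (j < _) => //; case: (a _).
Qed.

Lemma count_columns a C N : all (fun r => size r <= N) C ->
  count a (flatten C) = \sum_(0 <= j < N) count a (column C j).
Proof.
elim: C => [|r C IH] /=; first by rewrite big1.
case/andP=> rN /IH; rewrite count_cat => ->.
rewrite (count_row (0, 0) a rN) -big_split; apply: eq_bigr => j _ /=.
by rewrite /column /=; case: ifP.
Qed.

(** With weakly decreasing row lengths, the column of index j consists of the first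
    cells from the top, so its min(k, height) top cells all lie in the first [k]
    rows. *)
Lemma minn_count_take j k sh : sorted geq sh ->
  minn k (count (fun s => j < s) sh) <= count (fun s => j < s) (take k sh).
Proof.
rewrite (sorted_pairwise (rev_trans leq_trans)).
elim: sh k => [|s sh IH] [|k] //=; rewrite ?min0n ?minn0 //.
case/andP=> ssh psh; have [js|sj] := ltnP j s.
  by rewrite !add1n minnSS ltnS IH.
rewrite (eq_in_count (a2 := pred0)) ?count_pred0 ?minn0 // => t tsh /=.
by apply/negbTE; rewrite -leqNgt (leq_trans _ sj) // (allP ssh).
Qed.

Lemma sumn_counts sh N : all (fun s => s <= N) sh ->
  sumn sh = \sum_(0 <= j < N) count (fun s => j < s) sh.
Proof.
elim: sh => [|s sh IH] /=; first by rewrite big1.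
case/andP=> sN /IH ->; rewrite big_split /=; congr (_ + _).
rewrite -[in LHS](size_nseq s 0) -(count_predT (nseq s 0)).
rewrite (@count_row _ 0 _ _ N) ?size_nseq //.
by apply: eq_bigr => j _; rewrite andbT.
Qed.

(** Going down a column the letters increase while their positions in the reading
    word move left, so no two kept letters of a column share a colour. *)
Lemma column_kept k C j : pairwise (compatible k) (flatten (rev C)) ->
  pairwise dominates (map unzip1 C) -> kept k (column C j) <= minn k (size (column C j)).
Proof.
move=> pW pD; rewrite leq_min count_size andbT.
have pC : pairwise (fun r s => allrel (compatible k) s r) C.
  elim: C pW {pD} => //= r C IH; rewrite rev_cons flatten_rcons pairwise_cat.
  case/and3P=> Cr /IH -> _; rewrite andbT; apply/allP=> s sC.
  apply/allrelP=> p q ps; apply: (allrelP Cr); apply/flattenP; exists s => //.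
  by rewrite mem_rev.
have : pairwise (fun p q => (p.2 < k) ==> (p.2 != q.2)) (column C j).
  rewrite /column pairwise_map.
  have := conj pC pD; rewrite pairwise_map => /andP; rewrite -pairwise_relI.
  move/(pairwise_filter (fun r => j < size r)).
  apply: (@sub_in_pairwise _ (fun r => j < size r)); last exact: filter_all.
  move=> r s; rewrite !unfold_in => jr js /= /andP[/allrelP sr /dominatesP[_ /(_ j)]].
  rewrite !size_map js !(nth_map (0, 0)) // => /(_ isT) rs.
  apply/implyP=> rk; apply/eqP=> erk.
  have := sr _ _ (mem_nth (0, 0) js) (mem_nth (0, 0) jr).
  by rewrite /compatible -erk eqxx rk leqNgt rs.
move/(pairwise_filter (fun p => p.2 < k)).
move=> pu; rewrite /kept -size_filter -(size_map snd) -[leqRHS](size_iota 0).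
apply: uniq_leq_size; last first.
  by move=> _ /mapP[p + ->]; rewrite mem_filter mem_iota => /andP[].
rewrite uniq_pairwise pairwise_map; move: pu.
apply: (@sub_in_pairwise _ (fun p => p.2 < k)); last exact: filter_all.
by move=> p q; rewrite !unfold_in /= => ->.
Qed.

Lemma tableau_shape P : tableau P -> sorted geq (shape P).
Proof.
case/andP=> _; case: P => //= r P; rewrite path_map.
by apply: sub_path => s t /dominatesP[].
Qed.

(** Counting the kept letters by columns: a column of height h contributes at most
    min(k, h), which is the number of its cells in the first [k] rows. *)
Lemma tableau_kept_bound k P m : tableau P ->
  colorable k (reading P) m -> m <= sumn (take k (shape P)).
Proof.
move=> tP [W [eW pW <-]]; have [C [eWC eC]] := unzip1_flatten eW.
rewrite {W}eWC -[C]revK in eW pW *.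
move/(congr1 rev): eC; rewrite revK -map_rev; move: (rev C) pW => {eW} {}C pW eP.
have shC : shape C = shape P.
  by rewrite -eP /shape -map_comp; apply: eq_map => r /=; rewrite size_map.
have shP := tableau_shape tP; set N := head 0 (shape P).
have leN : all (fun s => s <= N) (shape P).
  rewrite /N; case: (shape P) shP => //= s sh.
  by rewrite (path_sortedE (rev_trans leq_trans)) leqnn => /andP[].
have /seq.permP eK : perm_eq (flatten (rev C)) (flatten C).
  by apply: perm_flatten; rewrite perm_rev.
rewrite /kept eK (@count_columns _ _ N); last first.
  by move: leN; rewrite -shC all_map.
rewrite (@sumn_counts _ N); last by apply/allP=> s /mem_take; apply: (allP leN).
apply: leq_sum => j _; apply: leq_trans (minn_count_take j k shP).
suff -> : count (fun s => j < s) (shape P) = size (column C j).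
  apply: column_kept => //; rewrite eP.
  by case/andP: tP => _; rewrite (sorted_pairwise dominates_trans).
by rewrite -shC count_map size_map size_filter.
Qed.

(** * Greene's theorem and the number of bumps *)

Lemma pairwise_enum_ord n (r : rel 'I_n) :
  pairwise r (enum 'I_n) <-> forall x y : 'I_n, x < y -> r x y.
Proof.
split=> [pr x y xy|H].
  have := pairwiseP x pr x y; rewrite !inE size_enum_ord !ltn_ord !nth_ord_enum.
  exact.
have : pairwise ltn (map val (enum 'I_n)).
  by rewrite val_enum_ord -(sorted_pairwise ltn_trans) iota_ltn_sorted.
by rewrite pairwise_map; apply: sub_pairwise => x y; apply: H.
Qed.

(** Colouring the letters of the one-line notation is colouring positions; weak
    and strict increase agree because a permutation has distinct values. *)
Lemma colorable_positions n (pi : 'S_n) k m :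
  colorable k (one_line pi) m <->
  exists2 c : 'I_n -> nat,
    forall x y : 'I_n, x < y -> c x = c y -> c x < k -> pi x < pi y &
    #|[set x | c x < k]| = m.
Proof.
have keptE (c : 'I_n -> nat) :
    kept k [seq ((pi x).+1, c x) | x <- enum 'I_n] = #|[set x | c x < k]|.
  by rewrite /kept count_map cardE [in RHS]/enum_mem size_filter enumT;
    apply: eq_count => x; rewrite !inE.
have compatE (c : 'I_n -> nat) :
    pairwise (compatible k) [seq ((pi x).+1, c x) | x <- enum 'I_n] <->
    forall x y : 'I_n, x < y -> c x = c y -> c x < k -> pi x < pi y.
  rewrite pairwise_map pairwise_enum_ord; split=> H x y xy.
    move=> cxy cx; have := H x y xy; rewrite /compatible /= cxy eqxx -cxy cx /= ltnS.
    by rewrite leq_eqVlt => /orP[/eqP/val_inj/perm_inj exy|//]; rewrite exy ltnn in xy.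
  apply/implyP=> /andP[/= /eqP cxy cx]; exact/ltnW/H.
split=> [[W [eW pW <-]]|[c inc <-]]; last first.
  exists [seq ((pi x).+1, c x) | x <- enum 'I_n]; split; last exact: keptE.
    by rewrite /unzip1 -map_comp.
  exact/compatE.
pose c (x : 'I_n) := (nth (0, 0) W x).2.
have szW : size W = n by rewrite -(size_map fst) -/(unzip1 W) eW size_map size_enum_ord.
have eWc : W = [seq ((pi x).+1, c x) | x <- enum 'I_n].
  apply: (@eq_from_nth _ (0, 0)) => [|i]; first by rewrite size_map size_enum_ord.
  rewrite szW => ltin; pose x := Ordinal ltin.
  rewrite (nth_map x) ?size_enum_ord // (nth_ord_enum x x) /c.
  rewrite [LHS]surjective_pairing; congr pair.
  rewrite -(nth_map _ 0) ?szW // -/(unzip1 W) eW (nth_map x) ?size_enum_ord //.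
  by rewrite (nth_ord_enum x x).
by rewrite eWc in pW *; exists c; [apply/compatE | rewrite keptE].
Qed.

(** A disjoint family of sets of positions is the same as a colouring whose colour
    classes below [k] are its members; positions outside the union get the
    colour [k]. *)
Lemma union_of_increasingP n (pi : 'S_n) k (S : {set 'I_n}) :
  reflect (exists2 c : 'I_n -> nat,
    forall x y : 'I_n, x < y -> c x = c y -> c x < k -> pi x < pi y &
    [set x | c x < k] = S) (union_of_increasing pi k S).
Proof.
apply: (iffP existsP) => [[F /and3P[/forallP inc _ /eqP ->]]|[c inc <-]].
  pose c x := if [pick a | x \in F a] is Some a then val a else k.
  have cP x : c x < k -> exists2 a : 'I_k, c x = a & x \in F a.
    by rewrite /c; case: pickP => [a xa _|]; [exists a | rewrite ltnn].
  exists c => [x y xy cxy cx|].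
    have [a cxa xa] := cP x cx; have [b cyb yb] : exists2 b : 'I_k, c y = b & y \in F b.
      by apply: cP; rewrite -cxy.
    have eab : a = b by apply: val_inj; rewrite -[LHS]cxa cxy.
    subst b; move: (inc a) => /forall_inP/(_ x xa)/forall_inP/(_ y yb).
    by rewrite xy.
  apply/setP=> x; rewrite inE; apply/idP/bigcupP => [/cP[a _ xa]|[a _ xa]].
    by exists a.
  by rewrite /c; case: pickP => [b _|/(_ a)]; rewrite ?ltn_ord ?xa.
exists [ffun a : 'I_k => [set x | c x == a]]; apply/and3P; split.
- apply/forallP=> a; apply/forall_inP=> x; rewrite ffunE inE => /eqP cx.
  apply/forall_inP=> y; rewrite inE => /eqP cy; apply/implyP=> xy.
  by apply: inc => //; rewrite cx.
- apply/forallP=> a; apply/forallP=> b; rewrite !ffunE; apply/implyP=> ab.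
  rewrite disjoint_subset; apply/subsetP=> x; rewrite !inE => /eqP->.
  by apply: contra ab => /eqP /val_inj ->.
apply/eqP/setP=> x; rewrite inE; apply/idP/bigcupP => [cx|[a _]].
  by exists (Ordinal cx) => //; rewrite ffunE inE.
by rewrite ffunE inE => /eqP->.
Qed.

Lemma colorable_union n (pi : 'S_n) k m :
  colorable k (one_line pi) m <->
  exists2 S, union_of_increasing pi k S & #|S| = m.
Proof.
rewrite colorable_positions; split=> [[c inc cm]|[S /union_of_increasingP[c inc <-] cm]].
  by exists [set x | c x < k] => //; apply/union_of_increasingP; exists c.
by exists c.
Qed.

Lemma colorable_rs_tableau k w m :
  colorable k w m <-> colorable k (reading (rs_tableau [::] w)) m.
Proof. by have := @reading_rs_tableau [::] w isT [::] [::] k m; rewrite /= !cats0. Qed.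

(** Greene's theorem: the most that [k] increasing subsequences can cover is the
    size of the first [k] rows, so the least that must be removed is the size of
    the other rows. *)
Lemma alpha_drop_shape n (pi : 'S_n) k :
  alpha k pi = sumn (drop k (shape (rs_tableau [::] (one_line pi)))).
Proof.
set P := rs_tableau [::] _; have tP : tableau P by apply: rs_tableau_tableau.
have szP : sumn (take k (shape P)) + sumn (drop k (shape P)) = n.
  rewrite -sumn_cat cat_take_drop (bump_from_weight _ _).1 //=.
  by rewrite size_map size_enum_ord.
have cardC (R : {set 'I_n}) : #|R| + #|~: R| = n by rewrite cardsC card_ord.
rewrite /alpha; case: arg_minnP => [|R unR minR].
  exact: union_of_increasing_setT.
have maxR : #|~: R| <= sumn (take k (shape P)).
  apply: tableau_kept_bound => //.
  by apply/(colorable_rs_tableau k (one_line pi))/colorable_union; exists (~: R).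
have /(colorable_rs_tableau k (one_line pi))/colorable_union[S unS cS] :
    colorable k (reading P) (sumn (take k (shape P))).
  by apply: colorable_rows; case/andP: tP.
have := minR (~: S); rewrite setCK unS => /(_ isT).
have := cardC R; have := cardC S; lia.
Qed.

(** The row of index b survives in the dropped tails exactly for i = 1, ..., b. *)
Lemma sum_drops_row_weight sh M : size sh <= M ->
  \sum_(1 <= i < M) sumn (drop i sh) = row_weight sh.
Proof.
elim: sh M => [|s sh IH] M /=; first by rewrite big1.
case: M => // M; rewrite ltnS big_add1 /= => shM; case: M shM => [|M] shM.
  by case: sh {IH} shM => // _; rewrite big_geq.
by rewrite big_nat_recl // drop0 -(IH M.+1) // addnC big_add1.
Qed.

Theorem theorem8 (n : nat) (hn : 1 <= n) (pi : 'S_n) :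
  series_from1 (fun i => alpha i pi) (rs_bump pi).
Proof.
pose P := rs_tableau [::] (one_line pi).
exists (size (shape P)) => M shM.
under eq_bigr do rewrite alpha_drop_shape.
by rewrite sum_drops_row_weight // (bump_from_weight _ _).2.
Qed.
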